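(* Let $(\mathcal{X},\mathfrak{X})$ be a separable measurable space, $\mathcal{Y}$ a separable real Hilbert space, and $\mathcal{H}$ a fixed separable vector-valued RKHS of functions $\mathcal{X}\to\mathcal{Y}$ with kernel $K$ satisfying $\sup_x\lVert K(x,x)\rVert_{\mathrm{op}}<B$ for some $B>0$. For constants $M,C>0$, let $\mathcal{P}(M,C)$ be the class of joint distributions $P$ of $(X,Y)$ on $\mathcal{X}\times\mathcal{Y}$ such that (i) $\mathbb{E}\lVert Y\rVert_\mathcal{Y}^2\le M$, and (ii) the regression function $f^*$ (a measurable function with $\mathbb{E}[Y\mid X]=f^*(X)$) satisfies $f^*=\iota f^*_\mathcal{H}$ for some $f^*_\mathcal{H}\in\mathcal{H}$ with $\lVert f^*_\mathcal{H}\rVert_\mathcal{H}^2\le C$, where $\iota:\mathcal{H}\to L^2(\mathcal{X},P_X;\mathcal{Y})$ is the inclusion. Suppose $\iota\mathcal{H}$ is dense in $L^2(\mathcal{X},P_X;\mathcal{Y})$ for all $P\in\mathcal{P}(M,C)$. For i.i.d. samples $(X_i,Y_i)_{i=1}^n\sim P$ and $\lambda>0$ let $\hat f_{n,\lambda}$ be the minimiser over $\mathcal{H}$ of $\frac1n\sum_{i=1}^n\lVert f(X_i)-Y_i\rVert_\mathcal{Y}^2+\lambda\lVert f\rVert_\mathcal{H}^2$. Then for all $n\in\mathbb{N}$, $\lambda>0$, $\delta>0$, $$\sup_{P\in\mathcal{P}(M,C)}P\left(\lVert\iota\hat f_{n,\lambda}-f^*\rVert_2^2\ge\frac{2B^2M}{n\lambda^2\delta}+2\lambda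 C\right)\le\delta.$$ In particular, if $\lambda=\lambda_n$ converges to $0$ at the rate $n^{-1/4}$, then $R(\hat f_{n,\lambda_n})-R(f^* )=\mathcal{O}_P(n^{-1/4})$ uniformly over $\mathcal{P}(M,C)$.
   Context: A vector-valued RKHS is a Hilbert space of functions $\mathcal{X}\to\mathcal{Y}$ with continuous evaluation maps $S_xf=f(x)$; its kernel is $K(x,x')y=S_xS_{x'}^*y$. $L^2(\mathcal{X},P_X;\mathcal{Y})$ is the Bochner space with norm $\lVert f\rVert_2=(\mathbb{E}\lVert f(X)\rVert_\mathcal{Y}^2)^{1/2}$, $P_X$ the $X$-marginal of $P$. $R(f)=\mathbb{E}\lVert f(X)-Y\rVert_\mathcal{Y}^2$, so $R(\hat f_{n,\lambda})-R(f^* )=\lVert\iota\hat f_{n,\lambda}-f^*\rVert_2^2$. $Z_n=\mathcal{O}_P(r_n)$ uniformly over a class means $\lim_{T\to\infty}\limsup_{n\to\infty}\sup_{P}P(|Z_n/r_n|>T)=0$. *)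

(* Defs.v *)
From mathcomp Require Import all_boot all_order all_algebra.
From mathcomp Require Import all_classical all_reals all_analysis.
Import Order.TTheory GRing.Theory Num.Theory.

Set Implicit Arguments.
Unset Strict Implicit.
Unset Printing Implicit Defensive.

Local Open Scope ring_scope.
Local Open Scope classical_set_scope.

(* Real Hilbert spaces.  A Hilbert space is represented as a complete normed *)
(* space V together with an inner product [ip] whose induced norm is the     *)
(* norm of V (completeness is then completeness for the inner-product norm). *)
Definition inner_product (R : realType) (V : normedModType R)
  (ip : V -> V -> R) : Prop :=
  [/\ forall u v, ip u v = ip v u,
      forall (a : R) u v w, ip (a *: u + v) w = a * ip u w + ip v w
    & forall v, `|v| ^+ 2 = ip v v].

Definition separable_normed (R : realType) (V : normedModType R) : Prop :=
  exists s : nat -> V, forall (v : V) (e : R), 0 < e ->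
    exists k, `|v - s k| < e.

Definition separable_measurable (d : measure_display) (T : measurableType d)
  : Prop :=
  exists G : nat -> set T, @measurable _ T = <<s range G >>.

Definition borel (R : realType) (Y : normedModType R) :=
  g_sigma_algebraType (@open Y).

(* Vector-valued RKHS.  [app] realizes the elements of H as functions        *)
(* X -> Y (linear, injective: H is a space of functions), with continuous    *)
(* evaluation maps S_x f = app f x.  K is its kernel: K(.,x')y is the        *)
(* function S_{x'}^* y of H, i.e. it lies in H and <f, K(.,x')y>_H =         *)
(* <f(x'), y>_Y for all f; hence K(x,x')y = S_x S_{x'}^* y.                  *)
Definition vv_RKHS (R : realType) (X : Type) (Y H : normedModType R)
  (ipY : Y -> Y -> R) (ipH : H -> H -> R) (app : H -> X -> Y) : Prop :=
  [/\ inner_product ipH,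
      forall (a : R) (f g : H) x, app (a *: f + g) x = a *: app f x + app g x,
      injective app
    & forall x, continuous (fun f : H => app f x)].

Definition is_kernel_of (R : realType) (X : Type) (Y H : normedModType R)
  (ipY : Y -> Y -> R) (ipH : H -> H -> R) (app : H -> X -> Y)
  (K : X -> X -> Y -> Y) : Prop :=
  forall (x' : X) (y : Y), exists k : H,
    (forall x, app k x = K x x' y) /\ (forall f : H, ipH f k = ipY (app f x') y).

Definition kernel_bounded_by (R : realType) (X : Type) (Y : normedModType R)
  (K : X -> X -> Y -> Y) (B : R) : Prop :=
  exists B0 : R, B0 < B /\
    forall (x : X) (y : Y), `|y| <= 1 -> `|K x x y| <= B0.

Section Model.
Context (R : realType) (dX : measure_display) (X : measurableType dX)
  (Y H : completeNormedModType R) (ipY : Y -> Y -> R) (ipH : H -> H -> R)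
  (app : H -> X -> Y).

Local Notation Yb := (borel Y).

Definition in_class (M C : R) (P : probability (X * Yb)%type R) (fH : H)
  : Prop :=
  [/\ (\int[P]_z ((`|(z.2 : Y)| ^+ 2)%:E) <= M%:E)%E,
      `|fH| ^+ 2 <= C,
      measurable_fun setT (app fH : X -> Yb)
    & (* E[Y | X] = fH(X): for every measurable A of X and every e in Y,
         E[1_A(X) <Y,e>] = E[1_A(X) <fH(X),e>] *)
      forall (A : set X), measurable A -> forall e : Y,
        (\int[P]_z ((\1_A z.1 * ipY (z.2 : Y) e)%:E) =
         \int[P]_z ((\1_A z.1 * ipY (app fH z.1) e)%:E))%E].

Definition in_P (M C : R) (P : probability (X * Yb)%type R) : Prop :=
  exists fH : H, in_class M C P fH.

Definition dense_in_L2 (P : probability (X * Yb)%type R) : Prop :=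
  forall g : X -> Yb, measurable_fun setT g ->
    (\int[P]_z ((`|(g z.1 : Y)| ^+ 2)%:E) < +oo)%E ->
    forall e : R, 0 < e -> exists f : H,
      (\int[P]_z ((`|app f z.1 - (g z.1 : Y)| ^+ 2)%:E) < e%:E)%E.

Definition iid_sample (n : nat) (P : probability (X * Yb)%type R)
  (dO : measure_display) (Omega : measurableType dO) (Q : probability Omega R)
  (Z : 'I_n -> Omega -> (X * Yb)%type) : Prop :=
  [/\ forall i, measurable_fun setT (Z i),
      forall i (A : set (X * Yb)%type), measurable A ->
        Q (Z i @^-1` A) = P A
    & forall A : 'I_n -> set (X * Yb)%type, (forall i, measurable (A i)) ->
        Q (\bigcap_i (Z i @^-1` A i)) = (\prod_(i < n) Q (Z i @^-1` A i))%E].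

Definition emp_obj (n : nat) (lam : R) (S : 'I_n -> (X * Yb)%type) (f : H)
  : R :=
  (n%:R)^-1 * (\sum_(i < n) `|app f (S i).1 - ((S i).2 : Y)| ^+ 2)
  + lam * `|f| ^+ 2.

Definition is_krr_estimator (n : nat) (lam : R) (dO : measure_display)
  (Omega : measurableType dO) (Z : 'I_n -> Omega -> (X * Yb)%type)
  (fhat : Omega -> H) : Prop :=
  forall (w : Omega) (f : H),
    emp_obj lam (fun i => Z i w) (fhat w) <= emp_obj lam (fun i => Z i w) f.

Definition L2_err2 (P : probability (X * Yb)%type R) (fH f : H) : \bar R :=
  (\int[P]_z ((`|app f z.1 - app fH z.1| ^+ 2)%:E))%E.

(* every element of H is a (Borel-)measurable function, so that the inclusion
   iota : H -> L^2(X, P_X; Y) is defined *)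
Definition H_measurable : Prop :=
  forall f : H, measurable_fun setT (app f : X -> Yb).

End Model.

Definition outer_prob_le (R : realType) (dO : measure_display)
  (Omega : measurableType dO) (Q : probability Omega R) (E : set Omega)
  (delta : R) : Prop :=
  exists F : set Omega, [/\ measurable F, E `<=` F & (Q F <= delta%:E)%E].

(* Main.v *)
(** Let [fl] be the population ridge solution, the point of [H] with
    [E <fl(X), g(X)> + lam <fl, g> = E <Y, g(X)>] for all [g]. Its bias satisfies
    [E |fl(X) - f*(X)|^2 <= lam C]. For the estimation error put
    [xi(x, y) = S_x^* (y - fl(x))]; this [H]-valued variable has weak mean
    [lam fl] and [E |xi|^2 <= B M]. Testing the empirical first-order condition
    against [fhat - fl] gives
    [lam |fhat - fl| <= |n^-1 sum_i xi(X_i, Y_i) - lam fl|], the right-hand side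
    has second moment at most [B M / n] because the cross terms vanish by
    independence, and Markov's inequality concludes.

    Vector-valued integrals are avoided: measurability and means are weak, that
    is, tested against vectors. *)

Require Import Defs.
From mathcomp Require Import all_boot all_order all_algebra.
From mathcomp Require Import all_classical all_reals all_analysis.
From mathcomp Require Import measurable_realfun ring lra.
Import Order.TTheory GRing.Theory Num.Theory.
Import numFieldNormedType.Exports.
Local Open Scope ring_scope.
Local Open Scope classical_set_scope.

Set Implicit Arguments.
Unset Strict Implicit.
Unset Printing Implicit Defensive.

(** * Inner products and coercive forms *)

(** One discriminant bound serves Cauchy-Schwarz, near-minimisers and the empirical first-order
    condition. When [c = 0] the function of [t] is affine, which forces [b = 0]. *)
Lemma quad_discr (R : realFieldType) (a b c : R) :
  0 <= c -> (forall t, 0 <= a + 2 * t * b + t ^+ 2 * c) -> b ^+ 2 <= a * c.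
Proof.
move=> c0 h; have [c00|cn0] := eqVneq c 0.
  rewrite c00 mulr0; have [->|bn0] := eqVneq b 0; first by rewrite expr0n.
  (* At this [t] the affine function equals [-1]. *)
  have := h (- (a + 1) / (2 * b)); rewrite c00 mulr0 addr0.
  have -> : 2 * (- (a + 1) / (2 * b)) * b = - (a + 1) by field.
  by move=> ?; exfalso; lra.
have cp : 0 < c by rewrite lt_def cn0.
(* The vertex of the parabola. *)
have := h (- b / c).
have -> : a + 2 * (- b / c) * b + (- b / c) ^+ 2 * c = (a * c - b ^+ 2) / c.
  by field.
by rewrite pmulr_lge0 ?invr_gt0// subr_ge0.
Qed.

Section InnerProduct.
Context (R : realType) (V : normedModType R) (ip : V -> V -> R).
Context (hip : inner_product ip).
Implicit Types (u v w : V) (a : R).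

Lemma ipC u v : ip u v = ip v u.
Proof. by case: hip. Qed.

Lemma ip_norm v : `|v| ^+ 2 = ip v v.
Proof. by case: hip. Qed.

Lemma ipDl u v w : ip (u + v) w = ip u w + ip v w.
Proof. by case: hip => _ /(_ 1 u v w) + _; rewrite scale1r mul1r. Qed.

Lemma ip0l w : ip 0 w = 0.
Proof.
by have := ipDl 0 0 w; rewrite addr0 => /esym/eqP; rewrite addrC -subr_eq0 addrK => /eqP.
Qed.

Lemma ipZl a u w : ip (a *: u) w = a * ip u w.
Proof. by case: hip => _ /(_ a u 0 w) + _; rewrite addr0 ip0l addr0. Qed.

Lemma ipNl u w : ip (- u) w = - ip u w.
Proof. by rewrite -scaleN1r ipZl mulN1r. Qed.

Lemma ipBl u v w : ip (u - v) w = ip u w - ip v w.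
Proof. by rewrite ipDl ipNl. Qed.

Lemma ipDr w u v : ip w (u + v) = ip w u + ip w v.
Proof. by rewrite !(ipC w) ipDl. Qed.

Lemma ipZr w a u : ip w (a *: u) = a * ip w u.
Proof. by rewrite !(ipC w) ipZl. Qed.

Lemma ipNr w u : ip w (- u) = - ip w u.
Proof. by rewrite !(ipC w) ipNl. Qed.

Lemma ipBr w u v : ip w (u - v) = ip w u - ip w v.
Proof. by rewrite ipDr ipNr. Qed.

Lemma ip_suml (I : Type) (s : seq I) (u : I -> V) w :
  ip (\sum_(i <- s) u i) w = \sum_(i <- s) ip (u i) w.
Proof. by elim/big_rec2: _ => [|i a b _ <-]; rewrite ?ip0l ?ipDl. Qed.

Lemma ip_sumr (I : Type) (s : seq I) (u : I -> V) w :
  ip w (\sum_(i <- s) u i) = \sum_(i <- s) ip w (u i).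
Proof. by rewrite ipC ip_suml; apply: eq_bigr => i _; rewrite ipC. Qed.

Lemma normD_ip u v : `|u + v| ^+ 2 = `|u| ^+ 2 + 2 * ip u v + `|v| ^+ 2.
Proof. by rewrite !ip_norm ipDl !ipDr (ipC v u); ring. Qed.

Lemma normB_ip u v : `|u - v| ^+ 2 = `|u| ^+ 2 - 2 * ip u v + `|v| ^+ 2.
Proof. by rewrite normD_ip ipNr normrN; ring. Qed.

Lemma normD_le2 u v : `|u + v| ^+ 2 <= 2 * `|u| ^+ 2 + 2 * `|v| ^+ 2.
Proof.
have := sqr_ge0 `|u - v|; rewrite normD_ip normB_ip.
by set a := `|u| ^+ 2; set b := `|v| ^+ 2; lra.
Qed.

Lemma ip_sqr_le u v : ip u v ^+ 2 <= `|u| ^+ 2 * `|v| ^+ 2.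
Proof.
apply: quad_discr => [|t]; first exact: sqr_ge0.
have -> : `|u| ^+ 2 + 2 * t * ip u v + t ^+ 2 * `|v| ^+ 2 = `|u + t *: v| ^+ 2.
  by rewrite normD_ip ipZr !ip_norm ipZl ipZr; ring.
exact: sqr_ge0.
Qed.

Lemma ip_CS u v : `|ip u v| <= `|u| * `|v|.
Proof.
rewrite -(@ler_pXn2r _ 2)// ?nnegrE ?mulr_ge0//.
by rewrite exprMn real_normK ?num_real ?ip_sqr_le.
Qed.

(** The factor 1/2 is dropped: only an integrable majorant is wanted. *)
Lemma ip_le_half u v : `|ip u v| <= `|u| ^+ 2 + `|v| ^+ 2.
Proof.
apply: (le_trans (ip_CS u v)).
by have := sqr_ge0 (`|u| - `|v|); have := normr_ge0 u; have := normr_ge0 v; nra.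
Qed.

End InnerProduct.

(* Near-minimisers of [q f f - 2 l f] are approximate solutions, and any two
   approximate solutions are close because [q] is coercive. *)
Lemma riesz_coercive (R : realType) (H : completeNormedModType R)
    (q : H -> H -> R) (l : H -> R) (alpha beta gamma : R) :
  (forall f g, q f g = q g f) ->
  (forall a f g h, q (a *: f + g) h = a * q f h + q g h) ->
  (forall a f g, l (a *: f + g) = a * l f + l g) ->
  0 < alpha -> (forall f, alpha * `|f| ^+ 2 <= q f f) ->
  (forall f g, `|q f g| <= beta * `|f| * `|g|) ->
  (forall f, `|l f| <= gamma * `|f|) ->
  exists f, forall g, q f g = l g.
Proof.
move=> qC qlin llin a0 qa qb lg.
have q0 f : 0 <= q f f by apply: le_trans (qa f); rewrite mulr_ge0 ?sqr_ge0// ltW.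
have qB f g h : q (f - g) h = q f h - q g h.
  by rewrite [f - g]addrC -scaleN1r qlin; ring.
(* The energy whose derivative at [f] along [g] is [2 * (q f g - l g)]. *)
pose J f := q f f - 2 * l f.
have JD f t g : J (f + t *: g) = J f + 2 * t * (q f g - l g) + t ^+ 2 * q g g.
  rewrite /J [f + _]addrC qlin llin [q g _]qC [q f (_ + _)]qC !qlin [q g f]qC; ring.
have Jlb : has_inf (range J).
  split; first by exists (J 0), 0.
  exists (- gamma ^+ 2 / alpha) => _ [f _ <-].
  (* Completing the square: [alpha * J f + gamma ^+ 2] is at least the square of [alpha] |f| -
     [gamma]. *)
  rewrite /J -subr_ge0.
  have -> : q f f - 2 * l f - - gamma ^+ 2 / alpha =
    (alpha * q f f - 2 * alpha * l f + gamma ^+ 2) / alpha by field; exact: lt0r_neq0.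
  apply: divr_ge0; last exact: ltW.
  have h1 := qa f; have h2 := ler_norm (l f); have h3 := lg f.
  have h4 := sqr_ge0 (alpha * `|f| - gamma).
  have h5 := ler_wpM2l (ltW a0) h1.
  have h6 := ler_wpM2l (ltW a0) (le_trans h2 h3).
  by move: h4 h5 h6; move: (q f f) (l f) `|f| => A L N; nra.
(* For [f] within 1/(n+1) of the infimum, 1/(n+1) + 2t(q(f,g) - l(g)) + t^2 q(g,g) is non-negative
   in [t], so the discriminant bounds the residual. *)
have approx n : exists f, forall g, (q f g - l g) ^+ 2 <= (n.+1%:R^-1) * q g g.
  have np : 0 < n.+1%:R^-1 :> R by rewrite invr_gt0 ltr0n.
  have [_ [f _ <-] hf] := inf_adherent np Jlb.
  exists f => g; apply: quad_discr => // t.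
  have : inf (range J) <= J (f + t *: g) by apply: ge_inf; [case: Jlb | exists (f + t *: g)].
  rewrite JD; move: hf; move: (inf _) (J f) (q f g - l g) n.+1%:R^-1 => m Jf d y; lra.
have [F hF] := choice approx.
have e0 n : 0 <= n.+1%:R^-1 :> R by rewrite invr_ge0.
(* Both residuals are tested against the difference [d] itself; they subtract to [q d d]. *)
have close n p : alpha * `|F n - F p| ^+ 2 <= 2 * (n.+1%:R^-1 + p.+1%:R^-1).
  apply: (le_trans (qa _)); set d := F n - F p.
  have hd : q d d = (q (F n) d - l d) - (q (F p) d - l d) by rewrite {1}/d qB; ring.
  have h1 := hF n d; have h2 := hF p d; have qd := q0 d.
  have h3 : q d d ^+ 2 <= 2 * (n.+1%:R^-1 + p.+1%:R^-1) * q d d.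
    rewrite [X in X ^+ 2]hd; move: h1 h2.
    move: (q (F n) d - l d) (q (F p) d - l d) (q d d) n.+1%:R^-1 p.+1%:R^-1.
    by move=> x y z a b; have := sqr_ge0 (x + y); nra.
  have [->|qn0] := eqVneq (q d d) 0; first by rewrite mulr_ge0// addr_ge0.
  by rewrite -(@ler_pM2r _ (q d d)) ?lt_def ?qn0// -expr2.
have cF : cvgn F.
  apply/cauchy_cvgP/cauchy_exP => e e0'.
  have se : 0 < alpha * e ^+ 2 / 4 by rewrite divr_gt0// mulr_gt0// exprn_gt0.
  have [N _ hN] : \forall n \near \oo, n.+1%:R^-1 < alpha * e ^+ 2 / 4.
    exact: (@near_infty_natSinv_lt R (PosNum se)).
  exists (F N), N => //= n /= Nn; rewrite -ball_normE/=.
  rewrite -(@ltr_pXn2r _ 2)// ?nnegrE ?(ltW e0')// -(@ltr_pM2l _ alpha)//.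
  apply: (le_lt_trans (close _ _)).
  have := hN _ (leqnn N); have := hN _ Nn; rewrite /=.
  by move: n.+1%:R^-1 N.+1%:R^-1 => x y; lra.

have Fl : `|limn F - F n| @[n --> \oo] --> (0 : R).
  rewrite -(normr0 H) -(subrr (limn F)).
  by apply: cvg_norm; exact: (cvgB (cvg_cst _) cF).
exists (limn F) => g; apply/eqP; rewrite -subr_eq0 -sqrf_eq0 eq_le sqr_ge0 andbT.
(* The residual of [F n] plus the effect of replacing [F n] by its limit; both tend to zero. *)
have ub n : (q (limn F) g - l g) ^+ 2 <=
    2 * (n.+1%:R^-1 * q g g + beta ^+ 2 * `|g| ^+ 2 * (`|limn F - F n| * `|limn F - F n|)).
  have -> : q (limn F) g - l g = (q (F n) g - l g) + q (limn F - F n) g by rewrite qB; ring.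
  have := hF n g; have : q (limn F - F n) g ^+ 2 <= (beta * `|limn F - F n| * `|g|) ^+ 2.
    rewrite -[q _ _ ^+ 2]real_normK ?num_real// ler_sqr ?nnegrE//.
    exact: le_trans (qb _ _).
  move: (q (F n) g - l g) (q (limn F - F n) g) n.+1%:R^-1 `|limn F - F n| => x y a b.
  by have := sqr_ge0 (x - y); nra.
have lim0 : 2 * (n.+1%:R^-1 * q g g + beta ^+ 2 * `|g| ^+ 2 *
    (`|limn F - F n| * `|limn F - F n|)) @[n --> \oo] --> (0 : R).
  have -> : 0 = 2 * (0 * q g g + beta ^+ 2 * `|g| ^+ 2 * (0 * 0)) :> R by ring.
  apply: cvgMr; apply: cvgD; last by apply: cvgMr; apply: cvgM.
  by apply: cvgMl; exact: cvg_harmonic.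
rewrite -(cvg_lim _ lim0)//; apply: limr_ge; first by apply/cvg_ex; eexists; exact: lim0.
exact: nearW.
Qed.

(** * Weak measurability and square integrability *)

Definition wmeas {R : realType} {d : measure_display} {T : measurableType d}
    {V : normedModType R} (ip : V -> V -> R) (u : T -> V) : Prop :=
  forall e, measurable_fun setT (fun t => ip (u t) e).

(** Takes the place of the Bochner space L^2(P; V). *)
Definition sqint {R : realType} {d : measure_display} {T : measurableType d}
    {V : normedModType R} (ip : V -> V -> R) (P : {measure set T -> \bar R})
    (u : T -> V) : Prop :=
  wmeas ip u /\ P.-integrable setT (EFin \o (fun t => `|u t| ^+ 2)).

(** Each [ip^~ e] is continuous by Cauchy-Schwarz, hence Borel. Through this lemma the Borel
    measurability of outputs and of elements of [H] is turned into weak measurability. *)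
Lemma wmeas_borel (R : realType) (d : measure_display) (T : measurableType d)
    (V : normedModType R) (ip : V -> V -> R) (u : T -> V) :
  inner_product ip -> measurable_fun setT (u : T -> borel V) -> wmeas ip u.
Proof.
move=> hip mu e.
have ce : continuous (ip^~ e).
  move=> v; apply/cvgrPdist_le => /= eps eps0.
  (* The [+ 1] keeps the divisor positive when [e = 0]. *)
  have e1 : 0 < `|e| + 1 by rewrite ltr_wpDl.
  near=> w; rewrite -(ipBl hip).
  apply: (le_trans (ip_CS hip _ _)).
  have : `|v - w| <= eps / (`|e| + 1).
    by near: w; apply: cvgr_dist_le; rewrite ?divr_gt0//; exact: cvg_id.
  rewrite ler_pdivlMr// => h; apply: le_trans h.
  by rewrite ler_wpM2l// lerDl.
have mi : measurable_fun setT (ip^~ e : borel V -> R).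
  apply: (measurability _ (RGenOpens.measurableE R)) => _ [_ [a [b ->]] <-].
  rewrite setTI; apply: sub_sigma_algebra.
  by apply: open_comp => [v _|]; [exact: ce | exact: interval_open].
exact: (measurableT_comp mi mu).
Unshelve. all: by end_near. Qed.

Section WeaklyMeasurable.
Context (R : realType) (d : measure_display) (T : measurableType d)
  (V : normedModType R) (ip : V -> V -> R)
  (hip : inner_product ip) (sV : separable_normed V).
Implicit Types u v : T -> V.

Lemma wmeas_cst (c : V) : wmeas ip (fun _ : T => c).
Proof. by move=> e; exact: measurable_cst. Qed.

Lemma wmeasD u v : wmeas ip u -> wmeas ip v -> wmeas ip (fun t => u t + v t).
Proof.
move=> mu mv e; under eq_fun do rewrite (ipDl hip).
exact: measurable_funD.
Qed.

Lemma wmeasZ (a : T -> R) u : measurable_fun setT a -> wmeas ip u ->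
  wmeas ip (fun t => a t *: u t).
Proof.
move=> ma mu e; under eq_fun do rewrite (ipZl hip).
exact: measurable_funM.
Qed.

Lemma wmeasB u v : wmeas ip u -> wmeas ip v -> wmeas ip (fun t => u t - v t).
Proof.
move=> mu mv e; under eq_fun do rewrite (ipBl hip).
exact: measurable_funB.
Qed.

Lemma wmeas_comp (d' : measure_display) (S : measurableType d') (phi : S -> T) u :
  measurable_fun setT phi -> wmeas ip u -> wmeas ip (u \o phi).
Proof. by move=> mphi mu e; exact: (measurableT_comp (mu e) mphi). Qed.

(* [`|x|^2] is the supremum of [2 <x, s> - `|s|^2] over a dense set of [s]. *)
Lemma measurable_normX2 u : wmeas ip u -> measurable_fun setT (fun t => `|u t| ^+ 2).
Proof.
move=> mu; have [s hs] := sV.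
apply: (measurability _ (RGenOInfty.measurableE R)) => _ [_ [a ->] <-].
rewrite setTI.
have -> : (fun t => `|u t| ^+ 2) @^-1` `]a, +oo[ =
    \bigcup_k ((fun t => 2 * ip (u t) (s k) - `|s k| ^+ 2) @^-1` `]a, +oo[).
  apply/seteqP; split => t /=; rewrite in_itv/= andbT.
    move=> au; pose e := `|u t| ^+ 2 - a.
    have e0 : 0 < e by rewrite subr_gt0.
    have se0 : 0 < Num.sqrt e by rewrite sqrtr_gt0.
    (* With |u - s|^2 < |u|^2 - a, expanding the square gives 2<u, s> - |s|^2 > a. *)
    have [k hk] := hs (u t) _ se0.
    exists k => //=; rewrite in_itv/= andbT.
    move: hk; rewrite -(@ltr_pXn2r _ 2)// ?nnegrE ?sqrtr_ge0//.
    rewrite sqr_sqrtr ?ltW// (normB_ip hip) /e; lra.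
  move=> [k _] /=; rewrite in_itv/= andbT.
  by have := sqr_ge0 `|u t - s k|; rewrite (normB_ip hip); lra.
apply: bigcupT_measurable => k; rewrite -[X in measurable X]setTI.
apply: measurable_funB => //; apply: measurable_funM => //; exact: mu.
Qed.

(** Polarisation reduces the inner product of two varying vectors to squared norms. *)
Lemma measurable_ip u v : wmeas ip u -> wmeas ip v ->
  measurable_fun setT (fun t => ip (u t) (v t)).
Proof.
move=> mu mv.
have -> : (fun t => ip (u t) (v t)) =
    (fun t => 2^-1 * (`|u t + v t| ^+ 2 - `|u t| ^+ 2 - `|v t| ^+ 2)).
  by apply/funext => t; rewrite (normD_ip hip); lra.
apply: measurable_funM => //; apply: measurable_funB; last exact: measurable_normX2.
apply: measurable_funB; last exact: measurable_normX2.
by apply: measurable_normX2; exact: wmeasD.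
Qed.

End WeaklyMeasurable.

(** * Integrability of real functions and of squared norms *)

Section Integrability.
Context (R : realType) (d : measure_display) (T : measurableType d)
  (P : {measure set T -> \bar R}).

Lemma integrable_le (f g : T -> R) : measurable_fun setT f ->
  (forall t, `|f t| <= g t) -> P.-integrable setT (EFin \o g) ->
  P.-integrable setT (EFin \o f).
Proof.
move=> mf fg ig; apply: le_integrable ig => //; first exact/measurable_EFinP.
by move=> t _ /=; rewrite lee_fin (le_trans (fg t))// ler_norm.
Qed.

Lemma integrableZ (a : R) (f : T -> R) : P.-integrable setT (EFin \o f) ->
  P.-integrable setT (EFin \o (fun t => a * f t)).
Proof. by move=> fi; exact: (integrableZl measurableT a fi). Qed.

Lemma Rintegral_norm_le (f h : T -> R) (c : R) :
  P.-integrable setT (EFin \o f) -> P.-integrable setT (EFin \o h) ->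
  (forall t, `|f t| <= c * h t) -> `|\int[P]_t f t| <= c * \int[P]_t h t.
Proof.
move=> fi hi fh; apply: (le_trans (le_normr_Rintegral _ fi)) => //.
rewrite -RintegralZl//; apply: le_Rintegral; [by []|exact: (integrable_norm fi)|exact: (integrableZ c hi)|].
by move=> t _; exact: fh.
Qed.

Lemma integrable_addr (f g : T -> R) : P.-integrable setT (EFin \o f) ->
  P.-integrable setT (EFin \o g) ->
  P.-integrable setT (EFin \o (fun t => f t + g t)).
Proof. by move=> fi gi; exact: (integrableD measurableT fi gi). Qed.

Lemma integrable_subr (f g : T -> R) : P.-integrable setT (EFin \o f) ->
  P.-integrable setT (EFin \o g) ->
  P.-integrable setT (EFin \o (fun t => f t - g t)).
Proof. by move=> fi gi; exact: (integrableB measurableT fi gi). Qed.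

Lemma Rintegral_sum (I : Type) (s : seq I) (f : I -> T -> R) :
  (forall i, P.-integrable setT (EFin \o f i)) ->
  P.-integrable setT (EFin \o (fun t => \sum_(i <- s) f i t)) /\
  \int[P]_t (\sum_(i <- s) f i t) = \sum_(i <- s) \int[P]_t f i t.
Proof.
move=> fi; elim: s => [|i s [IHi IH]].
  split.
    by under eq_fun do rewrite big_nil; exact: integrable0.
  by under eq_Rintegral do rewrite big_nil; rewrite big_nil /Rintegral integral0.
split.
  have -> : (fun t => \sum_(j <- i :: s) f j t) = (fun t => f i t + \sum_(j <- s) f j t).
    by apply/funext => t; rewrite big_cons.
  exact: integrable_addr.
under eq_Rintegral do rewrite big_cons.
by rewrite RintegralD// IH big_cons.
Qed.

End Integrability.

Lemma Rintegral_cst_prob (R : realType) (d : measure_display)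
    (T : measurableType d) (P : probability T R) (c : R) : \int[P]_z c = c.
Proof. by rewrite Rintegral_cst// [X in fine X](@probability_setT _ _ _ P) mulr1. Qed.

Section SquareIntegrable.
Context (R : realType) (d : measure_display) (T : measurableType d)
  (P : probability T R) (V : normedModType R) (ip : V -> V -> R)
  (hip : inner_product ip) (sV : separable_normed V).
Implicit Types u v : T -> V.

Lemma sqint_le u (g : T -> R) : wmeas ip u -> P.-integrable setT (EFin \o g) ->
  (forall t, `|u t| ^+ 2 <= g t) -> sqint ip P u.
Proof.
move=> mu gi ug; split => //; apply: (@integrable_le _ _ _ _ _ g) => //.
  exact: (measurable_normX2 hip sV).
by move=> t; rewrite ger0_norm ?sqr_ge0.
Qed.

Lemma sqint_bounded u (c : R) : wmeas ip u -> (forall t, `|u t| ^+ 2 <= c) ->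
  sqint ip P u.
Proof.
move=> mu uc; apply: (sqint_le mu _ uc).
exact: finite_measure_integrable_cst.
Qed.

Lemma sqint_cst (c : V) : sqint ip P (fun _ : T => c).
Proof.
by apply: (@sqint_bounded _ (`|c| ^+ 2)) => // e; exact: measurable_cst.
Qed.

Lemma sqintD u v : sqint ip P u -> sqint ip P v -> sqint ip P (fun t => u t + v t).
Proof.
move=> [mu iu] [mv iv].
apply: (@sqint_le _ (fun t => 2 * `|u t| ^+ 2 + 2 * `|v t| ^+ 2)).
- exact: wmeasD.
- by apply: integrable_addr; exact: integrableZ.
- by move=> t; exact: (normD_le2 hip).
Qed.

Lemma sqintZ (a : R) u : sqint ip P u -> sqint ip P (fun t => a *: u t).
Proof.
move=> [mu iu]; apply: (@sqint_le _ (fun t => a ^+ 2 * `|u t| ^+ 2)).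
- by apply: (wmeasZ hip) => //; exact: measurable_cst.
- exact: integrableZ.
- by move=> t; rewrite normrZ exprMn real_normK ?num_real.
Qed.

Lemma sqintB u v : sqint ip P u -> sqint ip P v -> sqint ip P (fun t => u t - v t).
Proof.
move=> su sv; under eq_fun do rewrite -scaleN1r.
by apply: sqintD => //; exact: sqintZ.
Qed.

Lemma sqint_ip u v : sqint ip P u -> sqint ip P v ->
  P.-integrable setT (EFin \o (fun t => ip (u t) (v t))).
Proof.
move=> [mu iu] [mv iv].
apply: (@integrable_le _ _ _ _ _ (fun t => `|u t| ^+ 2 + `|v t| ^+ 2)).
- exact: (measurable_ip hip sV).
- by move=> t; exact: (ip_le_half hip).
- exact: integrable_addr.
Qed.

(** |u| <= 1 + |u|^2, and constants are integrable for a probability. *)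
Lemma sqint_norm u : sqint ip P u -> P.-integrable setT (EFin \o (fun t => `|u t|)).
Proof.
move=> [mu iu]; apply: (@integrable_le _ _ _ _ _ (fun t => 1 + `|u t| ^+ 2)).
- have -> : (fun t => `|u t|) = (fun t => Num.sqrt (`|u t| ^+ 2)).
    by apply/funext => t; rewrite sqrtr_sqr normr_id.
  apply: measurableT_comp; last exact: (measurable_normX2 hip sV).
  by apply: continuous_measurable_fun; exact: sqrt_continuous.
- by move=> t; rewrite normr_id; have := sqr_ge0 (`|u t| - 1); have := normr_ge0 (u t); nra.
- by apply: integrable_addr => //; exact: finite_measure_integrable_cst.
Qed.

End SquareIntegrable.

(** * Variance of an empirical mean *)

Section Transfer.
Context (R : realType) (dO : measure_display) (O : measurableType dO)
  (d : measure_display) (T : measurableType d)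
  (Q : {measure set O -> \bar R}) (P : {measure set T -> \bar R}) (phi : O -> T).
Context (mphi : measurable_fun setT phi)
  (law : forall A, measurable A -> Q (phi @^-1` A) = P A).

(** Change of variables through the push-forward of [Q]. It is applied to one observation, to a pair
    of observations and to the projections of a product. *)
Lemma transfer_integral (f : T -> R) : measurable_fun setT f ->
  P.-integrable setT (EFin \o f) ->
  Q.-integrable setT (EFin \o (f \o phi)) /\
  \int[Q]_w f (phi w) = \int[P]_z f z.
Proof.
move=> mf fi; have mEf : measurable_fun setT (EFin \o f) by exact/measurable_EFinP.
have fiQ : Q.-integrable setT (EFin \o (f \o phi)).
  apply/integrableP; split; first by apply/measurable_EFinP; exact: measurableT_comp.
  move/integrableP : fi => [_]; apply: le_lt_trans.
  rewrite -(@eq_measure_integral _ _ _ setT P (pushforward Q phi)); last first.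
    by move=> A mA _; rewrite /= /pushforward law.
  rewrite (ge0_integral_pushforward mphi)//.
  exact: measurableT_comp.
split=> //; rewrite /Rintegral; congr fine.
rewrite -(@eq_measure_integral _ _ _ setT P (pushforward Q phi)); last first.
    by move=> A mA _; rewrite /= /pushforward law.
by rewrite (integral_pushforward mphi).
Qed.

End Transfer.

Section Variance.
Context (R : realType) (dO : measure_display) (O : measurableType dO)
  (d : measure_display) (T : measurableType d)
  (Q : probability O R) (P : probability T R) (n : nat) (Z : 'I_n -> O -> T).
Context (mZ : forall i, measurable_fun setT (Z i))
  (lawZ : forall i A, measurable A -> Q (Z i @^-1` A) = P A)
  (indep : forall A : 'I_n -> set T, (forall i, measurable (A i)) ->
     Q (\bigcap_i (Z i @^-1` A i)) = (\prod_(i < n) Q (Z i @^-1` A i))%E).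
Context (V : normedModType R) (ip : V -> V -> R)
  (hip : inner_product ip) (sV : separable_normed V).

(** A product measure is determined by its values on rectangles. There, the independence of all [n]
    coordinates gives that of two by putting [setT] in the other slots. *)
Lemma pair_law i j : i != j -> forall S, measurable S ->
  Q ((fun w => (Z i w, Z j w)) @^-1` S) = (P \x P)%E S.
Proof.
move=> ij S mS.
have mp : measurable_fun setT (fun w => (Z i w, Z j w)) by exact: measurable_fun_pair.
rewrite (@product_measure_unique _ _ _ _ _ P P
  (pushforward Q (fun w => (Z i w, Z j w))))// => A B mA mB.
rewrite /= /pushforward.
pose F k := if k == i then A else if k == j then B else setT.
have -> : (fun w => (Z i w, Z j w)) @^-1` (A `*` B) = \bigcap_k (Z k @^-1` F k).
  apply/seteqP; split => w /=.
    move=> [/= Ai Bj] k _; rewrite /= /F; case: eqP => [->//|_].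
    by case: eqP => [->|].
  move=> h; split => /=; first by have := h i I; rewrite /= /F eqxx.
  by have := h j I; rewrite /= /F eqxx eq_sym (negbTE ij).
rewrite indep; last first.
  by move=> k; rewrite /F; case: ifP => // _; case: ifP.
rewrite (bigD1 i)//= (bigD1 j) ?(eq_sym j)//= big1 ?mule1; last first.
  move=> k /andP[ki kj]; rewrite /F (negbTE ki) (negbTE kj) preimage_setT.
  exact: probability_setT.
by rewrite /F eqxx eq_sym (negbTE ij) eqxx !lawZ.
Qed.

(** Fubini on the pair: with the first coordinate fixed at [x], the inner integral is the weak mean
    of [a] tested against [a x], which is zero. *)
Lemma integral_cross (a : T -> V) i j : i != j -> sqint ip P a ->
  (forall e, \int[P]_z ip (a z) e = 0) ->
  \int[Q]_w ip (a (Z i w)) (a (Z j w)) = 0.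
Proof.
move=> ij sa ma; have [wa ia] := sa.
have m12 : measurable_fun setT (fun zz : T * T => ip (a zz.1) (a zz.2)).
  by apply: (measurable_ip hip sV); apply: wmeas_comp.
have i12 : (P \x P)%E.-integrable setT
    (EFin \o (fun zz : T * T => ip (a zz.1) (a zz.2))).
  have mN := measurable_normX2 hip sV wa.
  apply: (@integrable_le _ _ _ _ _ (fun zz => `|a zz.1| ^+ 2 + `|a zz.2| ^+ 2)) => //.
    by move=> zz; exact: (ip_le_half hip).
  have law1 A : measurable A -> (P \x P)%E (fst @^-1` A) = P A.
    move=> mA; rewrite (_ : fst @^-1` A = A `*` setT); last by rewrite setXT.
    by rewrite product_measure1E// [X in (_ * X)%E](@probability_setT _ _ _ P) mule1.
  have law2 A : measurable A -> (P \x P)%E (snd @^-1` A) = P A.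
    move=> mA; rewrite (_ : snd @^-1` A = setT `*` A); last by rewrite setTX.
    by rewrite product_measure1E// [X in (X * _)%E](@probability_setT _ _ _ P) mul1e.
  apply: integrable_addr.
    exact: (transfer_integral measurable_fst law1 mN ia).1.
  exact: (transfer_integral measurable_snd law2 mN ia).1.
have mp : measurable_fun setT (fun w => (Z i w, Z j w)) by exact: measurable_fun_pair.
have [_ ->] := @transfer_integral _ _ _ _ _ Q (P \x P)%E (fun w => (Z i w, Z j w)) mp
  (pair_law ij) _ m12 i12.
rewrite /Rintegral -(integral12_prod_meas1 i12) /fubini_F.
rewrite integral0_eq// => x _.
have := ma (a x); rewrite /Rintegral => h.
rewrite -[LHS]fineK.
  apply: (congr1 EFin); rewrite -[RHS]h; congr fine.
  by apply: eq_integral => y _ /=; rewrite (ipC hip).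
apply: integrable_fin_num => //.
exact: (sqint_ip hip sV (sqint_cst P hip sV (a x)) sa).
Qed.

(** Expanding the squared norm of the centred average leaves only the [n] diagonal terms, and
    centring at the weak mean [m] does not increase the second moment. *)
Lemma variance_mean (u : T -> V) (m : V) : (0 < n)%N -> sqint ip P u ->
  (forall e, \int[P]_z ip (u z) e = ip m e) ->
  let D w := n%:R^-1 *: (\sum_(i < n) u (Z i w)) - m in
  sqint ip Q D /\ \int[Q]_w (`|D w| ^+ 2) <= (\int[P]_z (`|u z| ^+ 2)) / n%:R.
Proof.
move=> n0 su mu D.
have n0R : n%:R != 0 :> R by rewrite pnatr_eq0 -lt0n.
pose a z := u z - m.
have sm : sqint ip P (fun _ : T => m).
  exact: sqint_cst.
have sa : sqint ip P a by exact: sqintB.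
have ma e : \int[P]_z ip (a z) e = 0.
  under eq_Rintegral do rewrite (ipBl hip).
  have ce : sqint ip P (fun _ : T => e).
    exact: sqint_cst.
  rewrite RintegralB//; [|exact: (sqint_ip hip sV su ce)|exact: (sqint_ip hip sV sm ce)].
  by rewrite mu Rintegral_cst_prob subrr.
have DE w : D w = n%:R^-1 *: (\sum_(i < n) a (Z i w)).
  rewrite /D /a sumrB scalerBr sumr_const card_ord -[m *+ n]scaler_nat scalerA mulVf//.
  by rewrite scale1r.
have DE2 w : `|D w| ^+ 2 = (n%:R^-1) ^+ 2 *
    \sum_(i < n) \sum_(j < n) ip (a (Z i w)) (a (Z j w)).
  rewrite DE normrZ exprMn real_normK ?num_real// (ip_norm hip) (ip_suml hip).
  by congr (_ * _); apply: eq_bigr => i _; rewrite (ip_sumr hip).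
have saZ i : sqint ip Q (a \o Z i).
  have [wa ia] := sa; split; first exact: wmeas_comp.
  have mN := measurable_normX2 hip sV wa.
  exact: (transfer_integral (mZ i) (@lawZ i) mN ia).1.
have iij i j : Q.-integrable setT (EFin \o (fun w => ip (a (Z i w)) (a (Z j w)))).
  exact: (sqint_ip hip sV (saZ i) (saZ j)).
have [iD ED] := Rintegral_sum (index_enum 'I_n)
  (fun i => (Rintegral_sum (index_enum 'I_n) (iij i)).1).
have wD : wmeas ip D.
  move=> e; have -> : (fun w => ip (D w) e) =
      (fun w => n%:R^-1 * \sum_(i < n) ip (a (Z i w)) e).
    by apply/funext => w; rewrite DE (ipZl hip) (ip_suml hip).
  apply: measurable_funM => //; apply: measurable_sum => i.
  by case: (saZ i) => + _; exact.
split.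
  split => //; rewrite (_ : (fun w => _) = (fun w => (n%:R^-1) ^+ 2 *
    \sum_(i < n) \sum_(j < n) ip (a (Z i w)) (a (Z j w)))); last exact/funext.
  exact: integrableZ.
under eq_Rintegral do rewrite DE2.
rewrite RintegralZl// ED.
have -> : \sum_(i < n) \int[Q]_w (\sum_(j < n) ip (a (Z i w)) (a (Z j w))) =
    n%:R * \int[P]_z (`|a z| ^+ 2).
  rewrite -[n in n%:R]card_ord mulr_natl -sumr_const; apply: eq_bigr => i _.
  rewrite (Rintegral_sum (index_enum 'I_n) (iij i)).2 (bigD1 i)//= big1 ?addr0; last first.
    by move=> j ji; apply: integral_cross => //; rewrite eq_sym.
  have [wa ia] := sa.
  rewrite -(transfer_integral (mZ i) (@lawZ i) (measurable_normX2 hip sV wa) ia).2.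
  by apply: eq_Rintegral => w _; rewrite (ip_norm hip).
have -> : n%:R^-1 ^+ 2 * (n%:R * \int[P]_z (`|a z| ^+ 2)) =
    (\int[P]_z (`|a z| ^+ 2)) / n%:R by field.
rewrite ler_wpM2r ?invr_ge0//.
have [wu iu] := su; have [wm im] := sm.
(* The cross term integrates to [ip m m] because [m] is the weak mean. *)
have -> : \int[P]_z (`|a z| ^+ 2) = \int[P]_z (`|u z| ^+ 2) - `|m| ^+ 2.
  under eq_Rintegral do rewrite (normB_ip hip).
  have ium := sqint_ip hip sV su sm.
  rewrite RintegralD//; last by apply: integrable_subr => //; exact: integrableZ.
  rewrite RintegralB//; last exact: integrableZ.
  rewrite RintegralZl// mu Rintegral_cst_prob -(ip_norm hip); ring.
by rewrite lerBlDr lerDl sqr_ge0.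
Qed.

End Variance.

(** * Conditional means *)

Section DominatedConvergence.
Context (R : realType) (d : measure_display) (T : measurableType d)
  (P : {measure set T -> \bar R}).

Lemma Rintegral_dominated_cvg (f_ : nat -> T -> R) (f g : T -> R) :
  (forall n, measurable_fun setT (f_ n)) ->
  (forall t, f_ n t @[n --> \oo] --> f t) ->
  P.-integrable setT (EFin \o f) -> P.-integrable setT (EFin \o g) ->
  (forall n t, `|f_ n t| <= g t) ->
  \int[P]_t f_ n t @[n --> \oo] --> \int[P]_t f t.
Proof.
move=> mf_ cf fi gi fg.
have finf : (\int[P]_t (f t)%:E)%E \is a fin_num by exact: integrable_fin_num.
apply: fine_cvg; rewrite fineK//.
apply: (@dominated_cvg _ _ _ _ setT measurableT (fun n => EFin \o f_ n)
  (EFin \o f) (EFin \o g)) => //.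
- by move=> n; exact/measurable_EFinP.
- by move=> t _; apply: cvg_EFin; [exact: nearW | exact: cf].
- by move=> n t _ /=; rewrite lee_fin.
Qed.

End DominatedConvergence.

Section ConditionalMean.
Context (R : realType) (d d' : measure_display) (T : measurableType d)
  (X : measurableType d') (P : probability T R) (p : T -> X)
  (mp : measurable_fun setT p)
  (V : normedModType R) (ip : V -> V -> R)
  (hip : inner_product ip) (sV : separable_normed V).
Context (W : T -> V) (sW : sqint ip P W).

Let ind (A : set X) : T -> R := fun z => \1_A (p z).

Let mind A : measurable A -> measurable_fun setT (ind A).
Proof. by move=> mA; apply: measurableT_comp mp; exact: measurable_indic. Qed.

Let ind_le1 A z : `|ind A z| <= 1.
Proof. by rewrite /ind indicE; case: (_ \in _); rewrite ?normr1 ?normr0. Qed.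

Lemma integrable_ind_mul (A : set X) (f : T -> R) : measurable A ->
  P.-integrable setT (EFin \o f) ->
  P.-integrable setT (EFin \o (fun z => \1_A (p z) * f z)).
Proof.
move=> mA fi; have mf : measurable_fun setT f.
  by apply/measurable_EFinP; exact: measurable_int fi.
apply: (@integrable_le _ _ _ _ _ (fun z => `|f z|)).
- by apply: measurable_funM => //; exact: mind.
- by move=> z; rewrite normrM ler_piMl//; exact: ind_le1.
- exact: (integrable_norm fi).
Qed.

(* [g \o p] is approximated within [e] by functions that take countably many
   values on sets of the form [p @^-1` A]. *)
Lemma orthogonal_of_indicators (g : X -> V) :
  (forall A, measurable A -> forall e, \int[P]_z (\1_A (p z) * ip (W z) e) = 0) ->
  wmeas ip g -> sqint ip P (g \o p) -> \int[P]_z ip (W z) (g (p z)) = 0.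
Proof.
move=> W0 wg sg; have [s hs] := sV; set phi := fun z => ip (W z) (g (p z)).
have iphi : P.-integrable setT (EFin \o phi) by exact: (sqint_ip hip sV sW sg).
have mphi : measurable_fun setT phi.
  by apply/measurable_EFinP; exact: measurable_int iphi.
have iW := sqint_norm hip sV sW.
(* E|W| may vanish, so the bound is applied with [e] divided by E|W| + 1. *)
suff key e : 0 < e -> `|\int[P]_z phi z| <= e * \int[P]_z `|W z|.
  apply/eqP; rewrite -normr_le0; apply/ler_addgt0Pl => e e0; rewrite addr0.
  have W1 : 0 < \int[P]_z `|W z| + 1 by rewrite ltr_wpDl// Rintegral_ge0.
  apply: (le_trans (key (e / (\int[P]_z `|W z| + 1)) _)); first by rewrite divr_gt0.
  by rewrite -mulrA ler_piMr ?(ltW e0)// mulrC ler_pdivrMr// mul1r lerDl.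
move=> e0.
(* The norms are squared so that [measurable_normX2] applies; by density these sets cover [X]. *)
pose A k := [set x | `|g x - s k| ^+ 2 < e ^+ 2].
have mA k : measurable (A k).
  have mk : measurable_fun setT (fun x => `|g x - s k| ^+ 2).
    by apply: (measurable_normX2 hip sV); apply: (wmeasB hip) => //; exact: wmeas_cst.
  have -> : A k = setT `&` (fun x => `|g x - s k| ^+ 2) @^-1` `]-oo, e ^+ 2[.
    by rewrite setTI; apply/seteqP; split => x /=; rewrite /A/= in_itv.
  exact: mk.
pose D N := \big[setU/set0]_(k < N) A k.
have mD N : measurable (D N) by apply: bigsetU_measurable.
(* On [E] the constant [s N] can be subtracted from [g] without changing the integral, by [W0]; what
   remains has norm below [e]. *)
have piece N E : measurable E -> E `<=` A N ->
    `|\int[P]_z (\1_E (p z) * phi z)| <= e * \int[P]_z (\1_E (p z) * `|W z|).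
  move=> mE EA.
  have ss : sqint ip P (fun _ : T => s N) by exact: (sqint_cst P hip sV).
  have -> : \int[P]_z (\1_E (p z) * phi z) =
      \int[P]_z (\1_E (p z) * ip (W z) (g (p z) - s N)).
    rewrite -[LHS]subr0 -(W0 _ mE (s N)) -RintegralB//.
    - by apply: eq_Rintegral => z _; rewrite (ipBr hip) mulrBr.
    - exact: integrable_ind_mul.
    - by apply: integrable_ind_mul => //; exact: (sqint_ip hip sV sW ss).
  have id : P.-integrable setT (EFin \o (fun z => \1_E (p z) * ip (W z) (g (p z) - s N))).
    apply: integrable_ind_mul => //.
    exact: (sqint_ip hip sV sW (sqintB hip sV sg ss)).
  have iE : P.-integrable setT (EFin \o (fun z => \1_E (p z) * `|W z|)).
    exact: integrable_ind_mul.
  apply: (le_trans (le_normr_Rintegral _ id)) => //.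
  rewrite -RintegralZl//; apply: le_Rintegral => //.
  - exact: (integrable_norm id).
  - exact: integrableZ.
  move=> z _; rewrite normrM indicE; case: (boolP (_ \in _)) => [|_]; last first.
    by rewrite normr0 !mul0r mulr0.
  rewrite inE => /EA; rewrite /A/= ltr_pXn2r ?nnegrE ?(ltW e0)// => h.
  rewrite normr1 !mul1r mulrC; apply: (le_trans (ip_CS hip _ _)).
  by rewrite ler_wpM2l// ltW.
have indU (E F : set X) x : [disjoint E & F] ->
    \1_(E `|` F) x = \1_E x + \1_F x :> R.
  move=> /disj_setPS EF; rewrite !indicE in_setU.
  case: (boolP (x \in E)) => xE; case: (boolP (x \in F)) => xF /=;
    rewrite ?addr0 ?add0r//.
  by case: (EF x); split; exact: set_mem.
have DN N : `|\int[P]_z (\1_(D N) (p z) * phi z)| <=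
    e * \int[P]_z (\1_(D N) (p z) * `|W z|).
  elim: N => [|N IH].
    by apply: (piece 0%N) => //; rewrite /D big_ord0.
  (* [A N] may overlap the earlier sets, so only its new part is added. *)
  have DS : D N.+1 = D N `|` (A N `\` D N).
    by rewrite /D big_ord_recr/= setUDr setDv setD0.
  have dj : [disjoint D N & A N `\` D N] by apply/disj_setPS => x [? []].
  have mAD : measurable (A N `\` D N) by exact: measurableD.
  have E1 : \int[P]_z (\1_(D N.+1) (p z) * phi z) = \int[P]_z (\1_(D N) (p z) * phi z)
      + \int[P]_z (\1_(A N `\` D N) (p z) * phi z).
    rewrite -RintegralD//; [|exact: integrable_ind_mul|exact: integrable_ind_mul].
    by apply: eq_Rintegral => z _; rewrite DS (indU _ _ _ dj) mulrDl.
  have E2 : \int[P]_z (\1_(D N.+1) (p z) * `|W z|) = \int[P]_z (\1_(D N) (p z) * `|W z|)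
      + \int[P]_z (\1_(A N `\` D N) (p z) * `|W z|).
    rewrite -RintegralD//; [|exact: integrable_ind_mul|exact: integrable_ind_mul].
    by apply: eq_Rintegral => z _; rewrite DS (indU _ _ _ dj) mulrDl.
  rewrite E1 E2 mulrDr; apply: (le_trans (ler_normD _ _)); apply: lerD => //.
  by apply: (piece N) => //; exact: subDsetl.
(* At every point the indicators of [D N] are eventually 1, and |phi| dominates. *)
have cv : \int[P]_z (\1_(D N) (p z) * phi z) @[N --> \oo] --> \int[P]_z phi z.
  apply: (@Rintegral_dominated_cvg _ _ _ _ _ phi (fun z => `|phi z|)) => //.
  - by move=> N; apply: measurable_funM => //; exact: mind.
  - move=> z; have [k hk] := hs (g (p z)) _ e0.
    apply: (@cvg_near_cst _ _ _ _ _ _); exists k.+1 => // N /= kN.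
    rewrite indicE mem_set ?mul1r// /D -bigcup_mkord; exists k => //=.
    by rewrite /A/= ltr_pXn2r ?nnegrE ?(ltW e0).
  - exact: (integrable_norm iphi).
  - by move=> N z; rewrite normrM ler_piMl//; exact: ind_le1.
have cvn : `|\int[P]_z (\1_(D N) (p z) * phi z)| @[N --> \oo] --> `|\int[P]_z phi z|.
  exact: cvg_norm.
rewrite -(cvg_lim _ cvn)//; apply: limr_le.
  by apply/cvg_ex; eexists; exact: cvn.
apply: nearW => N; apply: (le_trans (DN N)); rewrite ler_wpM2l ?(ltW e0)//.
apply: le_Rintegral => //; first exact: integrable_ind_mul.
by move=> z _; rewrite ler_piMl// (le_trans (ler_norm _))//; exact: ind_le1.
Qed.

End ConditionalMean.

(** * Population ridge regression *)

Section KernelBounds.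
Context (R : realType) (X : Type) (Y H : normedModType R)
  (ipY : Y -> Y -> R) (ipH : H -> H -> R) (app : H -> X -> Y)
  (K : X -> X -> Y -> Y) (B : R).
Context (hY : inner_product ipY) (hH : inner_product ipH)
  (hK : is_kernel_of ipY ipH app K) (hB : kernel_bounded_by K B).

(** For the unit vector [u] along f(x), |f(x)| = <f, k>, where [k] represents evaluation at [x]
    paired with [u]; moreover |k|^2 = <K(x,x)u, u> <= B. *)
Lemma app_normX2_le f x : `|app f x| ^+ 2 <= B * `|f| ^+ 2.
Proof.
have [B0 [B0B KB]] := hB; set t := `|app f x|.
have [->|t0] := eqVneq t 0.
  rewrite expr0n/= mulr_ge0 ?sqr_ge0// (le_trans _ (ltW B0B))//.
  (* [B0] is non-negative, since it bounds the norm of [K x x 0]. *)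
  by have := KB x 0; rewrite normr0 => /(_ ler01); apply: le_trans.
have tp : 0 < t by rewrite lt_def t0 normr_ge0.
pose u := t^-1 *: app f x.
have nu : `|u| = 1 by rewrite normrZ -/t gtr0_norm ?invr_gt0// mulVf.
have [k [kE kr]] := hK x u.
have fk : ipH f k = t by rewrite kr (ipZr hY) -(ip_norm hY) -/t; field.
have kB : `|k| ^+ 2 <= B.
  rewrite (ip_norm hH) kr kE; apply: (le_trans (ler_norm _)).
  apply: (le_trans (ip_CS hY _ _)); rewrite nu mulr1.
  by apply: (le_trans (KB _ _ _)); rewrite ?nu// ltW.
have := ip_sqr_le hH f k; rewrite fk => /le_trans; apply.
by rewrite mulrC ler_wpM2r// sqr_ge0.
Qed.

(** [adj x] is the adjoint of evaluation at [x], built by choice among representers. For k = adj x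
    y, |k|^2 = <k(x), y>, hence |k|^4 <= |k(x)|^2 |y|^2 <= B |k|^2 |y|^2. *)
Lemma adjoint_exists : exists adj : X -> Y -> H,
  (forall x y f, ipH f (adj x y) = ipY (app f x) y) /\
  (forall x y, `|adj x y| ^+ 2 <= B * `|y| ^+ 2).
Proof.
have adjP (xy : X * Y) : exists k : H, forall f, ipH f k = ipY (app f xy.1) xy.2.
  by have [k [_ kr]] := hK xy.1 xy.2; exists k.
have [a ha] := choice adjP; exists (fun x y => a (x, y)); split=> [x y f|x y].
  by rewrite ha.
set k := a (x, y); have kk : `|k| ^+ 2 = ipY (app k x) y by rewrite (ip_norm hH) ha.
have [->|k0] := eqVneq (`|k| ^+ 2) 0.
  have [k' [_ hk']] := hK x y; rewrite mulr_ge0 ?sqr_ge0//.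
  have [B0 [B0B KB]] := hB; apply: (le_trans _ (ltW B0B)).
  by have := KB x 0; rewrite normr0 => /(_ ler01); apply: le_trans.
rewrite -(@ler_pM2l _ (`|k| ^+ 2)) ?lt_def ?k0 ?sqr_ge0//.
rewrite -expr2 {1}kk; apply: (le_trans (ip_sqr_le hY _ _)).
rewrite [leRHS](_ : _ = B * `|k| ^+ 2 * `|y| ^+ 2); last by ring.
apply: ler_wpM2r; first exact: sqr_ge0.
exact: app_normX2_le.
Qed.

End KernelBounds.

Section Regression.
Context (R : realType) (dX : measure_display) (X : measurableType dX)
  (Y H : completeNormedModType R) (ipY : Y -> Y -> R) (ipH : H -> H -> R)
  (app : H -> X -> Y) (B M C : R).
Context (hY : inner_product ipY) (sY : separable_normed Y)
  (hH : inner_product ipH) (sH : separable_normed H)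
  (app_lin : forall (a : R) (f g : H) x, app (a *: f + g) x = a *: app f x + app g x)
  (mapp : H_measurable app) (B0 : 0 < B)
  (app_le : forall f x, `|app f x| ^+ 2 <= B * `|f| ^+ 2)
  (adj : X -> Y -> H)
  (adjE : forall x y f, ipH f (adj x y) = ipY (app f x) y)
  (adjB : forall x y, `|adj x y| ^+ 2 <= B * `|y| ^+ 2).

Lemma app_sub f g x : app (f - g) x = app f x - app g x.
Proof. by rewrite [f - g]addrC -scaleN1r app_lin scaleN1r addrC. Qed.

Lemma app_norm_le f x : `|app f x| <= Num.sqrt B * `|f|.
Proof.
rewrite -(@ler_pXn2r _ 2) ?nnegrE ?mulr_ge0 ?sqrtr_ge0//.
by rewrite exprMn sqr_sqrtr ?(ltW B0)// app_le.
Qed.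

Section Population.
Context (P : probability (X * borel Y)%type R) (fH : H)
  (hP : in_class ipY app M C P fH).
Local Notation T := (X * borel Y)%type.

Let outp (z : T) : Y := z.2.
Let feat (f : H) (z : T) : Y := app f z.1.

Lemma wmeas_output : wmeas ipY outp.
Proof. by apply: (wmeas_borel hY); exact: measurable_snd. Qed.

Lemma output_sqint : sqint ipY P outp /\ \int[P]_z (`|outp z| ^+ 2) <= M.
Proof.
have wo := wmeas_output; have mN := measurable_normX2 hY sY wo.
have [hM _ _ _] := hP.
have ge0 : (0 <= \int[P]_z (`|outp z| ^+ 2)%:E)%E.
  by apply: integral_ge0 => z _; rewrite lee_fin sqr_ge0.
have fin : (\int[P]_z (`|outp z| ^+ 2)%:E)%E \is a fin_num.
  by rewrite ge0_fin_numE//; apply: (le_lt_trans hM); rewrite ltry.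
split; last by rewrite -lee_fin /Rintegral fineK.
split => //; apply/integrableP; split; first exact/measurable_EFinP.
rewrite (eq_integral (fun z => (`|outp z| ^+ 2)%:E)).
  by apply: (le_lt_trans hM); rewrite ltry.
by move=> z _ /=; rewrite ger0_norm ?sqr_ge0.
Qed.

Lemma app_wmeas f : wmeas ipY (app f : X -> Y).
Proof. by apply: (wmeas_borel hY); exact: mapp. Qed.

Lemma feature_sqint f : sqint ipY P (feat f).
Proof.
apply: (@sqint_bounded _ _ _ _ _ _ hY sY _ (B * `|f| ^+ 2)).
  by apply: (wmeas_comp (@measurable_fst _ _ X (borel Y))); exact: app_wmeas.
by move=> z; exact: app_le.
Qed.

(** The regression property in [in_class] tests only against indicators times constant vectors;
    [orthogonal_of_indicators] extends it to the functions in [H]. *)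
Lemma residual_orthogonal f :
  \int[P]_z ipY (outp z - feat fH z) (feat f z) = 0.
Proof.
have [so _] := output_sqint; have sr := sqintB hY sY so (feature_sqint fH).
apply: (orthogonal_of_indicators (@measurable_fst _ _ X (borel Y)) hY sY sr).
- move=> A mA e; have [_ _ _ /(_ A mA e) hE] := hP.
  have se : sqint ipY P (fun _ : T => e) by exact: (sqint_cst P hY sY).
  have i1 := integrable_ind_mul (@measurable_fst _ _ X (borel Y)) mA (sqint_ip hY sY so se).
  have i2 := integrable_ind_mul (@measurable_fst _ _ X (borel Y)) mA
    (sqint_ip hY sY (feature_sqint fH) se).
  under eq_Rintegral do rewrite (ipBl hY) mulrBr.
  rewrite RintegralB//; apply/eqP; rewrite subr_eq0; apply/eqP.
  exact: (congr1 fine hE).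
- exact: app_wmeas.
- exact: feature_sqint.
Qed.

Context (lam : R) (lam0 : 0 < lam).

(** The normal equation is solved by [riesz_coercive] for the form E<f(X), g(X)> + lam <f, g>. *)
Lemma population_ridge : exists fl : H, forall g,
  \int[P]_z ipY (outp z - feat fl z) (feat g z) = lam * ipH fl g.
Proof.
have [so oM] := output_sqint.
have ii f g := sqint_ip hY sY (feature_sqint f) (feature_sqint g).
have io g := sqint_ip hY sY so (feature_sqint g).
pose q f g := \int[P]_z ipY (feat f z) (feat g z) + lam * ipH f g.
pose l g := \int[P]_z ipY (outp z) (feat g z).
have [fl hfl] : exists f, forall g, q f g = l g.
  (* Coercivity comes from the penalty, giving [lam]. The other two constants follow from |f(X)| <=
     sqrt(B) |f| and the finiteness of E|Y|. *)
  apply: (@riesz_coercive _ _ q l lam (B + lam) (\int[P]_z `|outp z| * Num.sqrt B)).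
  - move=> f g; rewrite /q (ipC hH); congr (_ + _).
    by apply: eq_Rintegral => z _; rewrite (ipC hY).
  - move=> a f g h; rewrite /q (ipDl hH) (ipZl hH).
    have -> : \int[P]_z ipY (feat (a *: f + g) z) (feat h z) =
      \int[P]_z (a * ipY (feat f z) (feat h z) + ipY (feat g z) (feat h z)).
      by apply: eq_Rintegral => z _; rewrite /feat app_lin (ipDl hY) (ipZl hY).
    by rewrite RintegralD//; [rewrite RintegralZl//; ring | exact: integrableZ].
  - move=> a f g; rewrite /l.
    have -> : \int[P]_z ipY (outp z) (feat (a *: f + g) z) =
      \int[P]_z (a * ipY (outp z) (feat f z) + ipY (outp z) (feat g z)).
      by apply: eq_Rintegral => z _; rewrite /feat app_lin (ipDr hY) (ipZr hY).
    by rewrite RintegralD//; [rewrite RintegralZl | exact: integrableZ].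
  - exact: lam0.
  - move=> f; rewrite /q -(ip_norm hH) lerDr; apply: Rintegral_ge0 => z _.
    by rewrite -(ip_norm hY) sqr_ge0.
  - move=> f g; apply: (le_trans (ler_normD _ _)).
    rewrite !mulrDl; apply: lerD.
      apply: (le_trans (Rintegral_norm_le (c := B * `|f| * `|g|) (h := fun=> 1) _ _ _)).
      - exact: ii.
      - exact: finite_measure_integrable_cst.
      - move=> z; rewrite mulr1; apply: (le_trans (ip_CS hY _ _)).
        have -> : B * `|f| * `|g| = (Num.sqrt B * `|f|) * (Num.sqrt B * `|g|).
          by rewrite -{1}(sqr_sqrtr (ltW B0)); ring.
        by apply: ler_pM => //; exact: app_norm_le.
      by rewrite Rintegral_cst_prob mulr1.
    rewrite normrM gtr0_norm// -mulrA ler_pM2l//; exact: (ip_CS hH).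
  - move=> f; apply: (le_trans (Rintegral_norm_le (c := Num.sqrt B * `|f|)
      (h := fun z => `|outp z|) _ _ _)).
    - exact: io.
    - exact: (sqint_norm hY sY so).
    - move=> z; apply: (le_trans (ip_CS hY _ _)); rewrite mulrC.
      by apply: ler_wpM2r => //; exact: app_norm_le.
    by rewrite [leRHS](_ : _ = Num.sqrt B * `|f| * \int[P]_z `|outp z|)//; ring.
exists fl => g; under eq_Rintegral do rewrite (ipBl hY).
by rewrite RintegralB//; have := hfl g; rewrite /q /l => <-; ring.
Qed.

Context (fl : H) (hfl : forall g,
  \int[P]_z ipY (outp z - feat fl z) (feat g z) = lam * ipH fl g).

(** Split Y as (Y - fl) + fl. By the ridge equation tested on [fl], twice the cross term is 2 lam
    |fl|^2 >= 0, so E|Y - fl|^2 <= E|Y|^2. *)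
Lemma ridge_residual_le : \int[P]_z (`|outp z - feat fl z| ^+ 2) <= M.
Proof.
have [so oM] := output_sqint; apply: le_trans oM.
have sf := feature_sqint fl; have [wr ir] := sqintB hY sY so sf.
have irf := sqint_ip hY sY (sqintB hY sY so sf) sf; have [_ iF] := sf.
have -> : \int[P]_z (`|outp z| ^+ 2) = \int[P]_z (`|outp z - feat fl z| ^+ 2) +
    2 * (lam * ipH fl fl) + \int[P]_z (`|feat fl z| ^+ 2).
  rewrite -hfl -RintegralZl// -RintegralD//; last exact: integrableZ.
  rewrite -RintegralD//; last by apply: integrable_addr => //; exact: integrableZ.
  apply: eq_Rintegral => z _.
  by have := normD_ip hY (outp z - feat fl z) (feat fl z); rewrite subrK.
rewrite -addrA lerDl addr_ge0//; first by rewrite -(ip_norm hH) !mulr_ge0 ?sqr_ge0// ltW.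
by apply: Rintegral_ge0 => z _; rewrite sqr_ge0.
Qed.

(** Subtracting the ridge equation from the orthogonality of the residual, both tested on fl - fH,
    gives E|fl - fH|^2 = lam (<fl, fH> - |fl|^2), which is at most lam |fH|^2. *)
Lemma ridge_bias_le : \int[P]_z (`|feat fl z - feat fH z| ^+ 2) <= lam * C.
Proof.
have [_ hC _ _] := hP; have [so _] := output_sqint.
have sf f := feature_sqint f.
have h := hfl (fl - fH); have h0 := residual_orthogonal (fl - fH).
have i1 := sqint_ip hY sY (sqintB hY sY so (sf fl)) (sf (fl - fH)).
have i2 := sqint_ip hY sY (sqintB hY sY so (sf fH)) (sf (fl - fH)).
have -> : \int[P]_z (`|feat fl z - feat fH z| ^+ 2) = - (lam * ipH fl (fl - fH)).
  rewrite -h -[RHS]add0r -h0 -RintegralB//; apply: eq_Rintegral => z _.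
  rewrite -(ipBl hY) (ip_norm hY) /feat app_sub; congr ipY.
  by apply/esym; rewrite opprB [LHS]addrC addrA subrK.
rewrite (ipBr hH) -(ip_norm hH) -mulrN ler_pM2l//; apply: le_trans hC.
have := ip_CS hH fl fH; have := ler_norm (ipH fl fH).
have := sqr_ge0 (`|fl| - `|fH|); have := normr_ge0 fl; have := normr_ge0 fH.
nra.
Qed.

(** Minus half the gradient in [H] of the squared loss at [fl]. *)
Let xi (z : T) : H := adj z.1 (outp z - feat fl z).

(** The adjoint multiplies squared norms by at most [B], and the residual of [fl] has second moment
    at most [M]. *)
Lemma score_sqint : sqint ipH P xi /\ \int[P]_z (`|xi z| ^+ 2) <= B * M.
Proof.
have [so _] := output_sqint; have [wr ir] := sqintB hY sY so (feature_sqint fl).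
have wx : wmeas ipH xi.
  move=> e; have [we _] := feature_sqint e.
  have -> : (fun z => ipH (xi z) e) = (fun z => ipY (feat e z) (outp z - feat fl z)).
    by apply/funext => z; rewrite (ipC hH) adjE.
  exact: (measurable_ip hY sY).
have sx : sqint ipH P xi.
  by apply: (sqint_le hH sH wx (integrableZ B ir)) => z; exact: adjB.
split=> //; apply: (@le_trans _ _ (\int[P]_z (B * `|outp z - feat fl z| ^+ 2))).
  apply: le_Rintegral => //; [by case: sx|exact: integrableZ|].
  by move=> z _; exact: adjB.
by rewrite RintegralZl// ler_pM2l//; exact: ridge_residual_le.
Qed.

(** This is the ridge equation read through the adjoint. *)
Lemma score_mean e : \int[P]_z ipH (xi z) e = ipH (lam *: fl) e.
Proof.
rewrite (ipZl hH) -hfl; apply: eq_Rintegral => z _.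
by rewrite (ipC hH) adjE (ipC hY).
Qed.

End Population.

End Regression.

(** * The empirical estimator *)

Section FirstOrder.
Context (R : realType) (dX : measure_display) (X : measurableType dX)
  (Y H : completeNormedModType R) (ipY : Y -> Y -> R) (ipH : H -> H -> R)
  (app : H -> X -> Y).
Context (hY : inner_product ipY) (hH : inner_product ipH)
  (app_lin : forall (a : R) (f g : H) x, app (a *: f + g) x = a *: app f x + app g x)
  (n : nat) (lam : R) (lam0 : 0 < lam) (S : 'I_n -> (X * borel Y)%type) (fh : H)
  (fh_min : forall f, emp_obj app lam S fh <= emp_obj app lam S f).

Lemma emp_obj_line f g t : emp_obj app lam S (f + t *: g) =
  emp_obj app lam S f +
  2 * t * (n%:R^-1 * \sum_(i < n) ipY (app f (S i).1 - ((S i).2 : Y)) (app g (S i).1)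
           + lam * ipH f g) +
  t ^+ 2 * (n%:R^-1 * \sum_(i < n) `|app g (S i).1| ^+ 2 + lam * `|g| ^+ 2).
Proof.
rewrite /emp_obj (normD_ip hH) (ipZr hH) normrZ exprMn real_normK ?num_real//.
have -> : \sum_(i < n) `|app (f + t *: g) (S i).1 - ((S i).2 : Y)| ^+ 2 =
    \sum_(i < n) `|app f (S i).1 - ((S i).2 : Y)| ^+ 2 +
    2 * t * \sum_(i < n) ipY (app f (S i).1 - ((S i).2 : Y)) (app g (S i).1) +
    t ^+ 2 * \sum_(i < n) `|app g (S i).1| ^+ 2.
  rewrite !mulr_sumr -!big_split; apply: eq_bigr => i _ /=.
  have -> : app (f + t *: g) (S i).1 - (S i).2 =
      (app f (S i).1 - (S i).2) + t *: app g (S i).1 :> Y.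
    by rewrite [f + _]addrC app_lin -addrA [LHS]addrC.
  by rewrite (normD_ip hY) (ipZr hY) normrZ exprMn real_normK ?num_real//; ring.
ring.
Qed.

(** Minimality along the line fh + t g makes a quadratic without constant term non-negative, so
    [quad_discr] with [a = 0] annihilates its linear coefficient. *)
Lemma emp_first_order g :
  n%:R^-1 * \sum_(i < n) ipY (app fh (S i).1 - ((S i).2 : Y)) (app g (S i).1)
  + lam * ipH fh g = 0.
Proof.
set b := LHS; set c := n%:R^-1 * \sum_(i < n) `|app g (S i).1| ^+ 2 + lam * `|g| ^+ 2.
have c0 : 0 <= c.
  rewrite addr_ge0// mulr_ge0 ?invr_ge0 ?sqr_ge0 ?(ltW lam0)//.
  by apply: sumr_ge0 => i _; rewrite sqr_ge0.
have hb : b ^+ 2 <= 0 * c.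
  apply: quad_discr => // t; rewrite add0r.
  by have := fh_min (fh + t *: g); rewrite emp_obj_line -/b -/c -addrA lerDl.
by apply/eqP; rewrite -sqrf_eq0 eq_le sqr_ge0 andbT -(mul0r c).
Qed.

(** Pairing the right-hand vector [D] with g = fh - fl gives lam |g|^2 plus the empirical second
    moment of g, which is non-negative; Cauchy-Schwarz then bounds lam |g| by |D|. *)
Lemma estimator_deviation (adj : X -> Y -> H) (fl : H) :
  (forall x y f, ipH f (adj x y) = ipY (app f x) y) ->
  lam ^+ 2 * `|fh - fl| ^+ 2 <=
  `|n%:R^-1 *: (\sum_(i < n) adj (S i).1 (((S i).2 : Y) - app fl (S i).1)) - lam *: fl| ^+ 2.
Proof.
move=> adjE; set D := _ - lam *: fl; set g := fh - fl.
have DE : ipH D g = n%:R^-1 * \sum_(i < n) `|app g (S i).1| ^+ 2 + lam * `|g| ^+ 2.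
  (* The first-order condition is inserted as an added zero, which replaces the outputs by values of
     [fh]. *)
  rewrite -[LHS]addr0 -[X in _ + X = _](emp_first_order g) /D (ipBl hH) !(ipZl hH) (ip_suml hH).
  have -> : \sum_(i < n) ipH (adj (S i).1 (((S i).2 : Y) - app fl (S i).1)) g =
      \sum_(i < n) `|app g (S i).1| ^+ 2
      - \sum_(i < n) ipY (app fh (S i).1 - ((S i).2 : Y)) (app g (S i).1).
    rewrite -sumrB; apply: eq_bigr => i _; rewrite (ipC hH) adjE (ipC hY) (ip_norm hY).
    rewrite -(ipBl hY); congr ipY; rewrite /g (app_sub app_lin).
    by rewrite opprB [RHS]addrC addrA subrK.
  have -> : `|g| ^+ 2 = ipH fh g - ipH fl g by rewrite (ip_norm hH) -(ipBl hH).
  ring.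
have h1 : lam * `|g| ^+ 2 <= `|D| * `|g|.
  apply: (le_trans _ (le_trans (ler_norm _) (ip_CS hH D g))).
  rewrite DE lerDr mulr_ge0 ?invr_ge0//; apply: sumr_ge0 => i _; exact: sqr_ge0.
have [g0|gn0] := eqVneq (`|g|) 0; first by rewrite g0 expr0n/= mulr0 sqr_ge0.
have gp : 0 < `|g| by rewrite lt_def gn0 normr_ge0.
move: h1; rewrite expr2 mulrA ler_pM2r// => h2.
rewrite -exprMn ler_pXn2r ?nnegrE ?mulr_ge0// ltW//.
Qed.

End FirstOrder.

(** * Markov's inequality and the finite-sample bound *)

Lemma markov_normX2 (R : realType) (d : measure_display) (T : measurableType d)
    (Q : probability T R) (V : normedModType R) (ip : V -> V -> R) (D : T -> V) (c v : R) :
  inner_product ip -> separable_normed V -> sqint ip Q D -> 0 < c ->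
  \int[Q]_w (`|D w| ^+ 2) <= v ->
  measurable [set w | c <= `|D w| ^+ 2] /\
  (Q [set w | (c <= `|D w| ^+ 2)%R] <= (v / c)%:E)%E.
Proof.
move=> hip sV [wD iD] c0 Dv; set F := [set w | _].
have mN := measurable_normX2 hip sV wD.
have mF : measurable F.
  have -> : F = setT `&` (fun w => `|D w| ^+ 2) @^-1` `[c, +oo[.
    by rewrite setTI; apply/seteqP; split => w /=; rewrite /F/= in_itv/= andbT.
  exact: mN.
split=> //.
have iF : Q.-integrable setT (EFin \o (\1_F : T -> R)) by exact: integrable_indic.
have QF : fine (Q F) = \int[Q]_w \1_F w by rewrite /Rintegral integral_indic// setIT.
(* It remains to integrate the pointwise bound of [c] times the indicator of [F] by |D|^2. *)
rewrite -[leLHS]fineK ?fin_num_measure// lee_fin ler_pdivlMr// QF -RintegralZr//.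
apply: le_trans Dv; apply: le_Rintegral => //.
  by under eq_fun do rewrite mulrC; exact: integrableZ.
move=> w _; rewrite indicE; case: (boolP (w \in F)) => [|_]; last by rewrite mul0r sqr_ge0.
by rewrite inE mul1r.
Qed.

(** The error is split at [fl] into estimation error and bias. Stated apart so that the rate can
    reuse it with [delta] set to the tolerance. *)
Lemma krr_finite_sample (R : realType) (dX : measure_display) (X : measurableType dX)
    (Y H : completeNormedModType R) (ipY : Y -> Y -> R) (ipH : H -> H -> R)
    (app : H -> X -> Y) (K : X -> X -> Y -> Y) (B M C : R) :
  inner_product ipY -> separable_normed Y ->
  vv_RKHS ipY ipH app -> separable_normed H ->
  is_kernel_of ipY ipH app K -> H_measurable app ->
  0 < B -> kernel_bounded_by K B -> 0 < M ->
  forall (n : nat), (0 < n)%N ->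
  forall lam : R, 0 < lam -> forall delta : R, 0 < delta ->
  forall (P : probability (X * borel Y)%type R) (fH : H),
    in_class ipY app M C P fH ->
  forall (dO : measure_display) (Omega : measurableType dO)
    (Q : probability Omega R) (Z : 'I_n -> Omega -> (X * borel Y)%type),
    iid_sample P Q Z ->
  forall fhat : Omega -> H, is_krr_estimator app lam Z fhat ->
    outer_prob_le Q
      [set w | (((2 * B ^+ 2 * M) / (n%:R * lam ^+ 2 * delta) + 2 * lam * C)%:E
                 <= L2_err2 app P fH (fhat w))%E]
      delta.
Proof.
move=> hY sY [hH app_lin _ _] sH hK mapp B0 hB M0 n n0 lam lam0 delta delta0 P fH hP.
move=> dO O Q Z [mZ lawZ indep] fhat hfhat.
have app_le := app_normX2_le hY hH hK hB.
have [adj [adjE adjB]] := adjoint_exists hY hH hK hB.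
have [fl hfl] := population_ridge hY sY hH app_lin mapp B0 app_le hP lam0.
have [sx xB] := score_sqint hY sY hH sH mapp B0 app_le adjE adjB hP lam0 hfl.
have bias := ridge_bias_le hY sY hH app_lin mapp app_le hP lam0 hfl.
have mx := score_mean hY hH adjE hfl.
have [sD vD] := variance_mean mZ lawZ indep hH sH n0 sx mx.
have nR0 : (0 : R) < n%:R by rewrite ltr0n.
(* The level at which Markov's inequality with second moment B M / n returns exactly [delta]. *)
pose c := B * M / (n%:R * delta).
have c0 : 0 < c by rewrite divr_gt0// mulr_gt0.
have vD' : \int[Q]_w (`|n%:R^-1 *: (\sum_(i < n) adj (Z i w).1
    (((Z i w).2 : Y) - app fl (Z i w).1)) - lam *: fl| ^+ 2) <= B * M / n%:R.
  by apply: (le_trans vD); rewrite ler_wpM2r// invr_ge0 ltW.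
have [mF QF] := markov_normX2 hH sH sD c0 vD'.
(* The covering event involves only the score average, whose measurability is known, whereas [fhat]
   is an arbitrary selection of minimisers. *)
exists [set w | c <= `|n%:R^-1 *: (\sum_(i < n) adj (Z i w).1
    (((Z i w).2 : Y) - app fl (Z i w).1)) - lam *: fl| ^+ 2]; split => //; last first.
  rewrite (_ : delta = B * M / n%:R / c)// /c; field.
  by rewrite !lt0r_neq0.
move=> w /=; set D := _ - lam *: fl => hw.
have dev : lam ^+ 2 * `|fhat w - fl| ^+ 2 <= `|D| ^+ 2.
  exact: (estimator_deviation hY hH app_lin lam0 (hfhat w) fl adjE).
have sf f := feature_sqint hY sY mapp app_le P f.
have [_ i1] := sqintB hY sY (sf (fhat w)) (sf fl).
have [_ i2] := sqintB hY sY (sf fl) (sf fH).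
have [_ i3] := sqintB hY sY (sf (fhat w)) (sf fH).
have errE : L2_err2 app P fH (fhat w) =
    (\int[P]_z (`|app (fhat w) z.1 - app fH z.1| ^+ 2))%:E.
  by rewrite /Rintegral fineK//; exact: integrable_fin_num.
(* |a + b|^2 <= 2|a|^2 + 2|b|^2 at the intermediate point [fl]; this is the source of both factors 2
   in the bound. *)
have err_le : \int[P]_z (`|app (fhat w) z.1 - app fH z.1| ^+ 2) <=
    2 * (B * `|fhat w - fl| ^+ 2) + 2 * (lam * C).
  apply: (@le_trans _ _ (\int[P]_z (2 * `|app (fhat w) z.1 - app fl z.1| ^+ 2 +
     2 * `|app fl z.1 - app fH z.1| ^+ 2))).
    apply: le_Rintegral => //; first by apply: integrable_addr; exact: integrableZ.
    move=> z _.
    by have := normD_le2 hY (app (fhat w) z.1 - app fl z.1) (app fl z.1 - app fH z.1);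
      rewrite addrA subrK.
  rewrite RintegralD//; [|exact: integrableZ|exact: integrableZ].
  rewrite !RintegralZl//; apply: lerD; last by rewrite ler_pM2l.
  rewrite ler_pM2l// -[leRHS](Rintegral_cst_prob P); apply: le_Rintegral => //.
    exact: finite_measure_integrable_cst.
  by move=> z _; rewrite -(app_sub app_lin); exact: app_le.
move: hw; rewrite errE lee_fin => /le_trans/(_ err_le).
rewrite [2 * (lam * C)]mulrA lerD2r => h.
have lam2 : 0 < lam ^+ 2 by rewrite exprn_gt0.
(* The threshold in terms of [c]: a large error forces lam^2 |fhat - fl|^2 >= c. *)
have cE : 2 * B ^+ 2 * M / (n%:R * lam ^+ 2 * delta) = 2 * B * c / lam ^+ 2.
  by rewrite /c; field; rewrite !lt0r_neq0.
move: h; rewrite cE ler_pdivrMr// => h; apply: le_trans dev.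
rewrite -(@ler_pM2l _ (2 * B)) ?mulr_gt0//; apply: (le_trans h).
by rewrite le_eqVlt; apply/orP; left; apply/eqP; ring.
Qed.

(** * Rates *)

(** Characterises the rate by n r^4 = 1, so that the remaining estimates use integer powers only. *)
Lemma powRN4 (R : realType) (n : nat) : (0 < n)%N ->
  let r := n%:R `^ (- 4^-1) : R in [/\ 0 < r, r <= 1 & n%:R * r ^+ 4 = 1].
Proof.
move=> n0 r; have nR : (0 : R) < n%:R by rewrite ltr0n.
have r0 : 0 < r by rewrite powR_gt0.
have r4 : n%:R * r ^+ 4 = 1.
  rewrite -powR_mulrn ?(ltW r0)// -powRrM mulNr mulVf// powR_inv1 ?ler0n//.
  by rewrite mulfV// lt0r_neq0.
split=> //; rewrite -(@ler_pXn2r _ 4) ?nnegrE ?(ltW r0)// expr1n -r4.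
by rewrite ler_peMl ?exprn_ge0 ?(ltW r0)// ler1n.
Qed.

(** The variance term is of order 1/(n r^2) = r^2 <= r, so the bias term, of order r, sets the
    rate. *)
Lemma rate_le (R : realFieldType) (A C c1 c2 lam r nn eps : R) :
  0 < nn -> 0 < r -> r <= 1 -> nn * r ^+ 4 = 1 -> 0 <= A -> 0 <= C -> 0 < c1 -> 0 < eps ->
  c1 * r <= lam -> lam <= c2 * r ->
  A / (nn * lam ^+ 2 * eps) + 2 * lam * C <= (A / (c1 ^+ 2 * eps) + 2 * c2 * C) * r.
Proof.
move=> n0 r0 r1 nr A0 C0 c10 e0 l1 l2; rewrite [leRHS](mulrDl _ _ r); apply: lerD; last first.
  by rewrite [leRHS](_ : _ = 2 * (c2 * r) * C); [rewrite ler_wpM2r// ler_pM2l|ring].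
have lam0 : 0 < lam by apply: lt_le_trans l1; rewrite mulr_gt0.
rewrite ler_pdivrMr ?mulr_gt0 ?exprn_gt0//.
rewrite [leRHS](_ : _ = A * (r * (nn * lam ^+ 2) / c1 ^+ 2)); last first.
  by field; rewrite !lt0r_neq0.
rewrite ler_peMr// ler_pdivlMr ?exprn_gt0// mul1r.
have l12 : (c1 * r) ^+ 2 <= lam ^+ 2.
  by rewrite ler_pXn2r ?nnegrE ?mulr_ge0 ?(ltW c10) ?(ltW r0) ?(ltW lam0).
apply: (@le_trans _ _ (r * (nn * (c1 * r) ^+ 2))); last by rewrite !ler_pM2l.
(* As r <= 1, n r^3 >= n r^4 = 1. *)
have -> : r * (nn * (c1 * r) ^+ 2) = c1 ^+ 2 * (nn * r ^+ 3) by ring.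
rewrite ler_peMr ?sqr_ge0// -nr; rewrite ler_pM2l// (exprS r 3) ler_piMl//.
by rewrite exprn_ge0 ?ltW.
Qed.

Unset Implicit Arguments.

Theorem theorem3p4 (R : realType) (dX : measure_display) (X : measurableType dX)
  (Y H : completeNormedModType R) (ipY : Y -> Y -> R) (ipH : H -> H -> R)
  (app : H -> X -> Y) (K : X -> X -> Y -> Y) (B M C : R) :
  separable_measurable X ->
  inner_product ipY -> separable_normed Y ->
  vv_RKHS ipY ipH app -> separable_normed H ->
  is_kernel_of ipY ipH app K ->
  H_measurable app ->
  0 < B -> kernel_bounded_by K B ->
  0 < M -> 0 < C ->
  (forall P : probability (X * borel Y)%type R,
      in_P ipY app M C P -> dense_in_L2 app P) ->
  (* the finite-sample bound *)
  (forall (n : nat), (0 < n)%N ->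
   forall lam : R, 0 < lam -> forall delta : R, 0 < delta ->
   forall (P : probability (X * borel Y)%type R) (fH : H),
     in_class ipY app M C P fH ->
   forall (dO : measure_display) (Omega : measurableType dO)
     (Q : probability Omega R) (Z : 'I_n -> Omega -> (X * borel Y)%type),
     iid_sample P Q Z ->
   forall fhat : Omega -> H, is_krr_estimator app lam Z fhat ->
     outer_prob_le Q
       [set w | (((2 * B ^+ 2 * M) / (n%:R * lam ^+ 2 * delta) + 2 * lam * C)%:E
                  <= L2_err2 app P fH (fhat w))%E]
       delta)
  /\
  (* in particular: lam_n of exact order n^(-1/4) gives
     R(fhat) - R(f^* ) = O_P(n^(-1/4)) uniformly over P(M,C) *)
  (forall lams : nat -> R, (forall n, 0 < lams n) ->
   (exists (c1 c2 : R) (N0 : nat), [/\ 0 < c1, 0 < c2 &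
      forall n, (N0 <= n)%N ->
        c1 * n%:R `^ (- 4^-1) <= lams n <= c2 * n%:R `^ (- 4^-1)]) ->
   forall eps : R, 0 < eps -> exists (T : R) (N : nat),
   forall n, (N <= n)%N ->
   forall (P : probability (X * borel Y)%type R) (fH : H),
     in_class ipY app M C P fH ->
   forall (dO : measure_display) (Omega : measurableType dO)
     (Q : probability Omega R) (Z : 'I_n -> Omega -> (X * borel Y)%type),
     iid_sample P Q Z ->
   forall fhat : Omega -> H, is_krr_estimator app (lams n) Z fhat ->
     outer_prob_le Q
       [set w | ((T * n%:R `^ (- 4^-1))%:E < L2_err2 app P fH (fhat w))%E]
       eps).
Proof.
move=> _ hY sY hR sH hK mapp B0 hB M0 C0 _; split.
  move=> n n0 lam lam0 delta delta0 P fH hP dO Omega Q Z iid fhat.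
  exact: (krr_finite_sample hY sY hR sH hK mapp B0 hB M0 n0 lam0 delta0 hP iid).
move=> lams lams0 [c1 [c2 [N0 [c10 c20 hl]]]] eps eps0.
(* The constant of [rate_le] with A = 2 B^2 M; it does not depend on [P], hence the uniformity. The
   maximum with 1 excludes the empty sample. *)
exists (2 * B ^+ 2 * M / (c1 ^+ 2 * eps) + 2 * c2 * C), (maxn N0 1) => n.
rewrite geq_max => /andP[Nn n0] P fH hP dO Omega Q Z iid fhat hfhat.
have [F [mF sub QF]] := krr_finite_sample hY sY hR sH hK mapp B0 hB M0 n0
  (lams0 n) eps0 hP iid hfhat.
(* Exceeding [T] times the rate entails reaching the finite-sample threshold, so [F] covers this
   event as well. *)
exists F; split => //; apply: subset_trans sub => w /= /ltW; apply: le_trans.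
have [r0 r1 nr] := powRN4 R n0; have /andP[l1 l2] := hl _ Nn.
rewrite lee_fin; apply: rate_le nr _ _ c10 eps0 l1 l2 => //.
- by rewrite ltr0n.
- by rewrite !mulr_ge0 ?sqr_ge0 ?ltW.
- exact: ltW.
Qed.
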